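(* Let $n\ge2$ and let $M=(m_{kl})\in\mathbb{R}^{n\times n}$ be a real Gram matrix satisfying $|m_{kl}|<\sqrt{m_{kk}m_{ll}}$ for all $k\neq l$. For each inverse eigenvector $\alpha\in\mathcal{I}(M)$ define $$c(\alpha)=\frac{1}{\det\bigl(I_n+\mathrm{D}(\alpha)M\mathrm{D}(\alpha)\bigr)}.$$ Then $c(\alpha)>0$ for every $\alpha\in\mathcal{I}(M)$, $$\sum_{\alpha\in\mathcal{I}(M)}c(\alpha)=1,\qquad\text{and}\qquad\sum_{\alpha\in\mathcal{I}(M)}c(\alpha)\,\alpha\otimes\alpha=\mathrm{Diag}(M)^{-1}.$$ Equivalently, $\mu_M=\sum_{\alpha\in\mathcal{I}(M)}c(\alpha)\,\delta_\alpha$ is a centered discrete probability measure on $\mathbb{R}^n$ whose covariance matrix is $$\int xx^\top\,d\mu_M=\mathrm{Diag}(M)^{-1}.$$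
   Context: A real Gram matrix is a real symmetric positive semidefinite matrix. For an $n\times n$ matrix $M$, the set of inverse eigenvectors is $\mathcal{I}(M)=\{\alpha\in\mathbb{C}^n:\ \alpha_k(M\alpha)_k=1\text{ for every }k\in\{1,\dots,n\}\}$; for a real Gram matrix it is a finite subset of $\mathbb{R}^n$. $\mathrm{D}(x)$ denotes the diagonal matrix with diagonal $x$; $\mathrm{Diag}(M)$ denotes the diagonal matrix with the same diagonal as $M$; $x\otimes y=xy^\top$; $\delta_\alpha$ is the Dirac measure at $\alpha$. A measure $\mu$ on $\mathbb{R}^n$ is centered if $\int x\,d\mu(x)=0$. *)

(* Defs.v *)
From HB Require Import structures.
From mathcomp Require Import all_boot all_order all_algebra.
From mathcomp Require Import all_classical all_reals all_analysis.
From mathcomp Require Import complex.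

Set Implicit Arguments.
Unset Strict Implicit.
Unset Printing Implicit Defensive.

Import Order.TTheory GRing.Theory Num.Theory.
Import numFieldNormedType.Exports.

Local Open Scope classical_set_scope.
Local Open Scope ring_scope.

Definition real_gram (R : realType) (n : nat) (M : 'M[R]_n) : Prop :=
  M^T = M /\ forall x : 'cV[R]_n, 0 <= (x^T *m M *m x) 0 0.

Definition diag_part (K : fieldType) (n : nat) (M : 'M[K]_n) : 'M[K]_n :=
  diag_mx (\row_k M k k).

(* [diag_mx] takes a row vector, hence the transpose. *)
Definition weight (K : fieldType) (n : nat) (M : 'M[K]_n) (a : 'cV[K]_n) : K :=
  1 / \det (1%:M + diag_mx a^T *m M *m diag_mx a^T).

Definition complex_mx (R : realType) (m n : nat) (A : 'M[R]_(m, n)) :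
  'M[R[i]]_(m, n) := map_mx (real_complex R) A.

Definition inverse_eigenvectors (R : realType) (n : nat) (M : 'M[R]_n) :
  set 'cV[R[i]]_n :=
  [set a : 'cV[R[i]]_n | forall k, a k 0 * (complex_mx M *m a) k 0 = 1].

Definition real_inverse_eigenvectors (R : realType) (n : nat) (M : 'M[R]_n) :
  set 'cV[R]_n :=
  [set a : 'cV[R]_n | inverse_eigenvectors M (complex_mx a)].

(* R^n, as column vectors, with its Borel sigma-algebra. *)
Definition borelRn (R : realType) (n : nat) :=
  g_sigma_algebraType (@open 'cV[R]_n).

Definition coordRn (R : realType) (n : nat) (i : 'I_n) (x : borelRn R n) : R :=
  (x : 'cV[R]_n) i 0.

(* A sum [\sum_(a \in A)] with infinite support is 0 by convention, so this is
   meaningful only when the set of inverse eigenvectors is finite. *)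
Definition inverse_eigenvector_measure (R : realType) (n : nat) (M : 'M[R]_n)
    (A : set (borelRn R n)) : \bar R :=
  (\sum_(a \in real_inverse_eigenvectors M)
     (weight M a)%:E * (\d_(a : borelRn R n) A))%E.

(* The Lebesgue integral is total, with +oo - +oo = -oo. As the integrands
   below are measurable, a finite value entails that they are integrable. *)
Definition centered (R : realType) (n : nat) (mu : set (borelRn R n) -> \bar R)
  : Prop :=
  forall i : 'I_n, (\int[mu]_x (coordRn i x)%:E = 0)%E.

Definition has_second_moment (R : realType) (n : nat)
    (mu : set (borelRn R n) -> \bar R) (C : 'M[R]_n) : Prop :=
  forall i j : 'I_n, (\int[mu]_x (coordRn i x * coordRn j x)%:E = (C i j)%:E)%E.

(* Main.v *)
Require Import Defs.
From HB Require Import structures.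
From mathcomp Require Import all_boot all_order all_algebra.
From mathcomp Require Import all_classical all_reals all_analysis.
From mathcomp Require Import complex.
From mathcomp Require Import fingroup perm measurable_realfun ring lra.

Import Order.TTheory GRing.Theory Num.Theory.
Import numFieldNormedType.Exports.

Local Open Scope classical_set_scope.
Local Open Scope ring_scope.

(** Write [a^S] for the product of the coordinates of [a] indexed by [S], and
    [p_S] for the principal minor of [M] on [S].

    Everything rests on a finite duality between sets of indices and inverse
    eigenvectors.  If [a] and [b] are inverse eigenvectors and [D] is the
    diagonal matrix with entries [a_k b_k], then [1 + D M] maps [a - b] to [0],
    because [a_k b_k ((M a)_k - (M b)_k) = b_k - a_k].  So the determinant of
    [1 + D M], which expands by rows into the sum over [S] of [p_S a^S b^S],
    vanishes when [a] and [b] differ, and it is [1 / c(a)] when [a = b].  In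
    terms of the matrix [V] with entries [a^S], this says that [V P V^T] is
    the inverse of [C], where [P] and [C] are the diagonal matrices of the [p_S]
    and of the [c(a)].  When [M] is positive definite, each of the [2^n] open
    orthants contains an inverse eigenvector (rescale a maximizer of the
    product of the coordinates on an ellipsoid), so [V] is square and the
    relation can be inverted: the sum over [a] of [c(a) a^S a^T] is [1 / p_S] if
    [S = T] and [0] otherwise ([moments_all_orthants]).  For [S] and [T] empty
    or singletons these are the total mass, the mean and the covariance.

    When [M] is only semidefinite, some orthants may be empty and [V] has too
    few rows.  The identity is then applied to [M + e] and [e] tends to [0].  In
    an orthant that contains an inverse eigenvector of [M], the regularized
    ones converge to it ([inveig_close]).  In an empty orthant they leave every
    compact set, so their weight [c] tends to [0]; this alone would not prevent
    second moments from escaping to infinity.  The strict inequality between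
    [|m_kl|] and the geometric mean of [m_kk] and [m_ll] says that [p_S > 0] for
    pairs [S], so that the identity for pairs bounds [c (b_k b_l)^2], hence
    [c b_k b_l] tends to [0] for distinct [k] and [l]; the equation
    [b_l (M b)_l + e b_l^2 = 1] transfers this to [c b_l^2]
    ([escaping_moment_cvg0]).

    Finally all complex inverse eigenvectors are real, because the imaginary
    part [v] of a solution satisfies [v_k (M v)_k <= 0] for every [k], with
    equality only if [v_k = 0] ([complex_inveig_real]). *)

(** * The duality between subsets of indices and inverse eigenvectors *)

Definition monomial {K : comNzRingType} {n} (a : 'cV[K]_n)
    (S : {set 'I_n}) : K :=
  \prod_(i in S) a i 0.

(** The rows outside [S] are replaced by those of the identity, which avoids
    submatrices whose size depends on [S]. *)
Definition principal_minor {K : comNzRingType} {n} (M : 'M[K]_n)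
    (S : {set 'I_n}) : K :=
  \det (\matrix_(i, j) if i \in S then M i j else (i == j)%:R).

Definition inverse_eigenvector {K : comNzRingType} {n} (M : 'M[K]_n)
    (a : 'cV[K]_n) :=
  forall k, a k 0 * (M *m a) k 0 = 1.

(** Up to the product of all coordinates of [a] and [b], this is the Bezoutian
    (determinant of divided differences) of the system [(M x)_k = 1 / x_k]. *)
Definition bezoutian {K : comNzRingType} {n} (M : 'M[K]_n)
    (a b : 'cV[K]_n) : K :=
  \sum_S principal_minor M S * (monomial a S * monomial b S).

(** Row [i] of the matrix is a unit row plus [z_i] times row [i] of [M]; the
    set [S] records which of the two is chosen in each row. *)
Lemma det_diag_expand {K : comNzRingType} {n} (M : 'M[K]_n) (z : 'cV[K]_n) :
  \det (1%:M + diag_mx z^T *m M) = \sum_S principal_minor M S * monomial z S.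
Proof.
rewrite /determinant.
under eq_bigr => s _.
  under eq_bigr => i _ do rewrite mxE addrC mul_diag_mx !mxE.
  rewrite bigA_distr big_distrr /=; over.
rewrite exchange_big /=; apply: eq_big => [S|S _]; first by rewrite inE.
rewrite /principal_minor /determinant mulr_suml; apply: eq_bigr => s _.
rewrite -mulrA; congr (_ * _).
rewrite /monomial [X in _ * X]big_mkcond -big_split /=; apply: eq_bigr => i _.
by rewrite mxE; case: ifP => _; rewrite ?mulr1 // mulrC.
Qed.

Lemma principal_minor0 {K : comNzRingType} {n} (M : 'M[K]_n) :
  principal_minor M finset.set0 = 1.
Proof.
rewrite -[RHS](det1 K n); congr (\det _).
by apply/matrixP => i j; rewrite !mxE inE.
Qed.

Lemma principal_minor1 {K : comNzRingType} {n} (M : 'M[K]_n) (k : 'I_n) :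
  principal_minor M [set k]%SET = M k k.
Proof.
rewrite /principal_minor /determinant (bigD1 1%g) //= [X in _ + X]big1 ?addr0;
  last first.
  move=> s ns1; rewrite (_ : \prod_i _ = 0) ?mulr0 //.
  have [i /andP[ik nsi]] : exists i, (i != k) && (s i != i).
    apply/existsP; apply: contraR ns1 => /existsPn fixs.
    suff s1 i : i != k -> s i = i.
      apply/eqP/permP => i; rewrite perm1.
      have [->|/s1//] := eqVneq i k.
      by apply/eqP; apply/negPn/negP => /[dup] /s1 /perm_inj -> /eqP.
    by move=> ik; have := fixs i; rewrite ik /= negbK => /eqP.
  apply/eqP; rewrite (bigD1 i) //= mxE inE (negPf ik).
  by rewrite [i == _]eq_sym (negPf nsi) mul0r.
rewrite odd_perm1 expr0 mul1r (bigD1 k) //= big1 ?mulr1 => [|i ik].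
  by rewrite mxE perm1 set11.
by rewrite mxE perm1 inE (negPf ik) eqxx.
Qed.

(** Only permutations that fix every index outside [k] and [l] contribute: the
    identity and the transposition. *)
Lemma principal_minor2 {K : comNzRingType} {n} (M : 'M[K]_n) (k l : 'I_n) :
  k != l ->
  principal_minor M [set k; l]%SET = M k k * M l l - M k l * M l k.
Proof.
move=> kl; rewrite /principal_minor /determinant (bigD1 1%g) //=.
have t1 : tperm k l != 1%g.
  by apply: contraNneq kl => /permP/(_ k); rewrite tpermL perm1 => ->.
rewrite (bigD1 (tperm k l)) //= [X in _ + (_ + X)]big1 ?addr0; last first.
  move=> s /andP[ns1 nst]; rewrite (_ : \prod_i _ = 0) ?mulr0 //.
  have [i /and3P[ik il nsi]] : exists i, [&& i != k, i != l & s i != i].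
    apply/existsP; apply: contraR ns1 => /existsPn fixs.
    have fixi i : i != k -> i != l -> s i = i.
      by move=> ik il; have := fixs i; rewrite ik il /= negbK => /eqP.
    have skl m : m \in [set k; l]%SET -> s m \in [set k; l]%SET.
      apply: contraLR; rewrite !inE !negb_or => /andP[ik il].
      by have /perm_inj e := fixi _ ik il; rewrite -e ik il.
    have [skk|nskk] := eqVneq (s k) k.
      apply/eqP/permP => i; rewrite perm1.
      have [->//|ik] := eqVneq i k.
      have [il|il] := eqVneq i l; last exact: fixi.
      have := skl i; rewrite il !inE eqxx orbT => /(_ isT)/orP[]/eqP //.
      by move=> slk; rewrite -(inj_eq (@perm_inj _ s)) skk slk eqxx in kl.
    have sk : s k = l.
      by have := skl k; rewrite !inE eqxx (negPf nskk) => /(_ isT)/eqP.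
    have sl : s l = k.
      have := skl l; rewrite !inE eqxx orbT => /(_ isT)/orP[]/eqP //.
      by move=> sll; rewrite -(inj_eq (@perm_inj _ s)) sk sll eqxx in kl.
    case/negP: nst; apply/eqP/permP => i.
    by case: tpermP => [->|->|/eqP ik /eqP il] //; exact: fixi.
  apply/eqP; rewrite (bigD1 i) //= mxE !inE (negPf ik) (negPf il).
  by rewrite [i == _]eq_sym (negPf nsi) mul0r.
have two (F : 'I_n -> K) : (forall i, i != k -> i != l -> F i = 1) ->
    \prod_i F i = F k * F l.
  move=> F1; rewrite (bigD1 k) //= (bigD1 l) 1?eq_sym //= big1 ?mulr1 //.
  by move=> i /andP[]; exact: F1.
rewrite odd_perm1 odd_tperm kl expr0 mul1r expr1 mulN1r.
congr (_ - _);
  rewrite two ?mxE ?perm1 ?tpermL ?tpermR ?inE ?eqxx ?orbT // => i ik il.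
  by rewrite mxE perm1 !inE (negPf ik) (negPf il) eqxx.
by rewrite mxE tpermD 1?eq_sym // !inE (negPf ik) (negPf il) eqxx.
Qed.

Lemma bezoutianE {K : comNzRingType} {n} (M : 'M[K]_n) (a b : 'cV[K]_n) :
  bezoutian M a b = \det (1%:M + diag_mx (\row_i (a i 0 * b i 0)) *m M).
Proof.
rewrite -[\row_i _]trmxK det_diag_expand; apply: eq_bigr => S _; congr (_ * _).
by rewrite /monomial -big_split; apply: eq_bigr => i _; rewrite !mxE.
Qed.

(** The vector [a - b] lies in the kernel of the matrix of [bezoutianE]. *)
Lemma bezoutian_neq {K : fieldType} {n} (M : 'M[K]_n) (a b : 'cV[K]_n) :
  inverse_eigenvector M a -> inverse_eigenvector M b -> a != b ->
  bezoutian M a b = 0.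
Proof.
move=> ra rb ab; apply/eqP; rewrite bezoutianE -det_tr; apply/det0P.
exists (a - b)^T.
  by apply: contra_neq ab => /(congr1 trmx); rewrite trmxK trmx0 => /subr0_eq.
rewrite -trmx_mul mulmxDl mul1mx -mulmxA mulmxBr mul_diag_mx.
apply/matrixP => i j; rewrite !mxE (ord1 i).
have := ra j; have := rb j; rewrite !mxE => hb ha.
set A := \sum_(_ < _) _ in ha *; set B := \sum_(_ < _) _ in hb *.
transitivity (a j 0 - b j 0 + (a j 0 * A * b j 0 - a j 0 * (b j 0 * B))).
  by ring.
by rewrite ha hb; ring.
Qed.

Lemma inveig_neq0 {K : comNzRingType} {n} (M : 'M[K]_n) (a : 'cV[K]_n) k :
  inverse_eigenvector M a -> a k 0 != 0.
Proof.
move=> /(_ k) ak; apply/eqP => a0.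
by move/eqP: ak; rewrite a0 mul0r eq_sym oner_eq0.
Qed.

(** The matrices [1 + D M D] and [1 + D^2 M] are conjugate by [D]. *)
Lemma weight_bezoutian {K : fieldType} {n} (M : 'M[K]_n) (a : 'cV[K]_n) :
  (forall k, a k 0 != 0) -> weight M a = (bezoutian M a a)^-1.
Proof.
move=> a0; rewrite /weight div1r; congr (_^-1); rewrite bezoutianE.
have dn0 : \det (diag_mx a^T) != 0.
  by rewrite det_diag; apply/prodf_neq0 => i _; rewrite mxE.
apply: (mulfI dn0); rewrite [RHS]mulrC -!det_mulmx; congr (\det _).
rewrite mulmxDr mulmxDl mulmx1 mul1mx !mulmxA; congr (_ + _ *m _ *m _).
rewrite mulmx_diag; congr diag_mx; apply/rowP => i.
by rewrite !mxE.
Qed.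

(** A one-sided inverse of a square matrix is two-sided, for matrices indexed by
    an arbitrary finite type. *)
Lemma biorthogonal_sym {K : fieldType} {T : finType} (F G : T -> T -> K) :
  (forall a b, \sum_t F a t * G t b = (a == b)%:R) ->
  forall a b, \sum_t G a t * F t b = (a == b)%:R.
Proof.
move=> FG a b.
pose mx (H : T -> T -> K) : 'M[K]_(#|T|) :=
  \matrix_(i, j) H (enum_val i) (enum_val j).
have mxM H H' i j :
    (mx H *m mx H') i j = \sum_t H (enum_val i) t * H' t (enum_val j).
  rewrite mxE; under eq_bigr do rewrite !mxE.
  by rewrite [RHS](reindex (@enum_val T T)) //=; apply/onW_bij/enum_val_bij.
have /mulmx1C /matrixP/(_ (enum_rank a) (enum_rank b)) : mx F *m mx G = 1%:M.
  by apply/matrixP => i j; rewrite mxM FG mxE (inj_eq enum_val_inj).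
by rewrite mxM mxE !enum_rankK (inj_eq enum_rank_inj).
Qed.

(** There are as many vectors [r s] as sets of indices, so the orthogonality of
    the rows given by [bezoutian_neq] implies the orthogonality of the
    columns. *)
Lemma moments_all_orthants {K : fieldType} {n} (M : 'M[K]_n)
    (r : {set 'I_n} -> 'cV[K]_n) :
  injective r -> (forall s, inverse_eigenvector M (r s)) ->
  (forall s, bezoutian M (r s) (r s) != 0) ->
  forall S T,
    principal_minor M T *
      (\sum_s weight M (r s) * (monomial (r s) S * monomial (r s) T)) =
    (S == T)%:R.
Proof.
move=> r_inj rr d0 S T.
pose F s U := weight M (r s) * (principal_minor M U * monomial (r s) U).
pose G U s := monomial (r s) U.
rewrite -(@biorthogonal_sym _ _ F G).
  by rewrite mulr_sumr; apply: eq_bigr => s _; rewrite /F /G; ring.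
move=> s t; rewrite /F /G.
transitivity (weight M (r s) * bezoutian M (r s) (r t)).
  by rewrite mulr_sumr; apply: eq_bigr => U _; ring.
have [<-|st] := eqVneq s t; last by rewrite bezoutian_neq ?mulr0 // (inj_eq r_inj).
by rewrite weight_bezoutian ?mulVf // => k; exact: inveig_neq0.
Qed.

(** * Inverse eigenvectors of positive semidefinite matrices *)

Definition qform {K : comNzRingType} {n} (M : 'M[K]_n) (x : 'cV[K]_n) : K :=
  \sum_k x k 0 * (M *m x) k 0.

Definition psd {R : numDomainType} {n} (M : 'M[R]_n) :=
  forall x, 0 <= qform M x.

Lemma qformE {K : comNzRingType} {n} (M : 'M[K]_n) (x : 'cV[K]_n) :
  (x^T *m M *m x) 0 0 = qform M x.
Proof.
by rewrite -mulmxA mxE; apply: eq_bigr => k _; rewrite mxE.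
Qed.

(** The polynomial [det (1 + t A)] is [1] at [t = 0] and has no root [t >= 0],
    so it is still positive at [t = 1]. *)
Lemma det_add1_gt0 {R : rcfType} {n} (A : 'M[R]_n) :
  psd A -> 0 < \det (1%:M + A).
Proof.
move=> A0.
pose p : {poly R} := \det (1%:M + 'X *: map_mx polyC A).
have pE t : p.[t] = \det (1%:M + t *: A).
  rewrite -/(horner_eval t p) -det_map_mx; congr (\det _).
  rewrite map_mxD map_mx1; congr (_ + _); apply/matrixP => i j.
  by rewrite !mxE /= horner_evalE hornerM hornerX hornerC.
rewrite ltNge; apply/negP => d0.
have [||t /andP[t0 _]] := @poly_ivt R (- p) 0 1; rewrite ?ler01 //.
  apply/andP; split; rewrite hornerN pE; last by rewrite scale1r oppr_ge0.
  by rewrite scale0r addr0 det1 lerN10.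
rewrite rootN /root pE => /det0P[v v0 /(congr1 (fun u => (u *m v^T) 0 0))].
rewrite mulmxDr mulmx1 mulmxDl -scalemxAr -scalemxAl mul0mx.
have : 0 < (v *m v^T) 0 0.
  have /rV0Pn[k vk] := v0.
  rewrite mxE (bigD1 k) //= ltr_pwDl // ?mxE -?expr2 ?exprn_even_gt0 //.
  by apply: sumr_ge0 => i _; rewrite mxE -expr2 sqr_ge0.
have := A0 v^T; rewrite -qformE trmxK => q0 vv.
rewrite mxE [X in _ + X]mxE [RHS]mxE => /eqP.
by rewrite gt_eqF // ltr_pwDl // mulr_ge0.
Qed.

Lemma bezoutian_gt0 {R : rcfType} {n} (M : 'M[R]_n) (a : 'cV[R]_n) :
  psd M -> (forall k, a k 0 != 0) -> 0 < bezoutian M a a.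
Proof.
move=> M0 a0; rewrite -invr_gt0 -weight_bezoutian // /weight div1r invr_gt0.
apply: det_add1_gt0 => x.
have := M0 (diag_mx a^T *m x); rewrite -!qformE trmx_mul tr_diag_mx.
by rewrite !mulmxA.
Qed.

(** The difference of the two sides is the value of the quadratic form at
    [b - a]: substitute [(M a)_k = 1 / a_k] and [(M b)_k = 1 / b_k - e b_k]. *)
Lemma inveig_perturb {R : realFieldType} {n} (M : 'M[R]_n) (e : R)
    (a b : 'cV[R]_n) :
  psd M -> inverse_eigenvector M a ->
  inverse_eigenvector (M + e%:M) b ->
  \sum_k (b k 0 - a k 0) ^+ 2 / (a k 0 * b k 0) <=
  e * \sum_k (a k 0 * b k 0 - b k 0 ^+ 2).
Proof.
move=> M0 ra rb; rewrite -subr_ge0.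
suff -> : e * \sum_k (a k 0 * b k 0 - b k 0 ^+ 2) -
    \sum_k (b k 0 - a k 0) ^+ 2 / (a k 0 * b k 0) = qform M (b - a) by exact: M0.
rewrite mulr_sumr -sumrB; apply: eq_bigr => k _.
have ak0 := inveig_neq0 _ _ k ra; have bk0 := inveig_neq0 _ _ k rb.
have Ea : (M *m a) k 0 = (a k 0)^-1 by apply: (mulfI ak0); rewrite mulfV ?ra.
have Eb : (M *m b) k 0 = (b k 0)^-1 - e * b k 0.
  apply: (mulfI bk0); rewrite mulrBr mulfV // -(rb k) mulmxDl mul_scalar_mx !mxE.
  by ring.
rewrite mulmxBr !mxE.
move: Ea Eb; rewrite !mxE => -> ->.
by field; rewrite ak0 bk0.
Qed.

(** By [inveig_perturb] the norm of [b] is at most that of [a], which then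
    bounds both the denominators and the right-hand side there. *)
Lemma inveig_close {R : realFieldType} {n} (M : 'M[R]_n) (e : R)
    (a b : 'cV[R]_n) :
  psd M -> inverse_eigenvector M a ->
  inverse_eigenvector (M + e%:M) b ->
  0 < e -> (forall k, 0 < a k 0 * b k 0) ->
  forall k, (b k 0 - a k 0) ^+ 2 <= e * (\sum_j a j 0 ^+ 2) ^+ 2.
Proof.
move=> M0 ra rb e0 ab k; set N := \sum_j _.
have ter j : 0 <= (b j 0 - a j 0) ^+ 2 / (a j 0 * b j 0).
  by rewrite divr_ge0 ?sqr_ge0 // ltW.
have P := inveig_perturb M e a b M0 ra rb.
have S0 : 0 <= \sum_k (a k 0 * b k 0 - b k 0 ^+ 2).
  by rewrite -(pmulr_rge0 _ e0); apply: le_trans P; exact: sumr_ge0.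
move: S0 P; rewrite sumrB.
set ip := \sum_k a k 0 * b k 0; set Nb := \sum_k b k 0 ^+ 2 => S0 P.
have ipN : ip *+ 2 <= N + Nb.
  rewrite -sumrMnl -big_split /=; apply: ler_sum => j _; rewrite mulr2n.
  by rewrite -subr_ge0 (_ : _ - _ = (a j 0 - b j 0) ^+ 2) ?sqr_ge0 //; ring.
have {ipN}ipN : ip <= N by move: ipN; rewrite mulr2n; lra.
have Nb0 : 0 <= Nb by apply: sumr_ge0 => j _; exact: sqr_ge0.
have abN : a k 0 * b k 0 <= N.
  apply: le_trans ipN; rewrite /ip (bigD1 k) //= lerDl.
  by apply: sumr_ge0 => j _; exact: ltW.
have : (b k 0 - a k 0) ^+ 2 / (a k 0 * b k 0) <= e * N.
  apply: le_trans (_ : e * (ip - Nb) <= _); last by rewrite ler_pM2l //; lra.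
  apply: le_trans P; rewrite (bigD1 k) //= lerDl.
  by apply: sumr_ge0.
rewrite ler_pdivrMr // => /le_trans; apply.
by rewrite expr2 mulrA ler_wpM2l // mulr_ge0 // ltW // (lt_le_trans (ab k)).
Qed.

(** The case [e = 0] of [inveig_perturb], where a sum of nonnegative terms is
    [<= 0]. *)
Lemma inveig_unique {R : realFieldType} {n} (M : 'M[R]_n) (a b : 'cV[R]_n) :
  psd M -> inverse_eigenvector M a -> inverse_eigenvector M b ->
  (forall k, 0 < a k 0 * b k 0) -> a = b.
Proof.
move=> M0 ra rb ab.
have rb0 : inverse_eigenvector (M + 0%:M) b by rewrite raddf0 addr0.
have P := inveig_perturb M 0 a b M0 ra rb0; rewrite mul0r in P.
have ter j : 0 <= (b j 0 - a j 0) ^+ 2 / (a j 0 * b j 0).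
  by rewrite divr_ge0 ?sqr_ge0 // ltW.
apply/colP => k.
have : \sum_k (b k 0 - a k 0) ^+ 2 / (a k 0 * b k 0) == 0.
  by rewrite eq_le P sumr_ge0.
rewrite psumr_eq0 // => /allP/(_ k); rewrite mem_index_enum => /(_ isT).
by rewrite mulf_eq0 invr_eq0 (gt_eqF (ab k)) orbF sqrf_eq0 subr_eq0 => /eqP.
Qed.

(** With [a = u + i v], the equations [a_k (M a)_k = 1] give
    [v_k (M v)_k (u_k^2 + v_k^2) = - v_k^2].  So all terms of the nonnegative
    number [v^T M v] are [<= 0], hence they vanish, and then so does [v]. *)
Lemma complex_inveig_real {R : rcfType} {n} (M : 'M[R]_n) (a : 'cV[R[i]]_n) :
  psd M ->
  (forall k, a k 0 * (map_mx (real_complex R) M *m a) k 0 = 1) ->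
  a = map_mx (real_complex R) (\col_k complex.Re (a k 0)).
Proof.
move=> M0 ra.
pose u : 'cV[R]_n := \col_k complex.Re (a k 0).
pose v : 'cV[R]_n := \col_k complex.Im (a k 0).
have aE k : a k 0 = (u k 0 +i* v k 0)%C by rewrite !mxE; case: (a k 0).
have MaE k : (map_mx (real_complex R) M *m a) k 0 =
    ((M *m u) k 0 +i* (M *m v) k 0)%C.
  apply/eqP; rewrite eq_complex !mxE !raddf_sum /=; apply/andP.
  by split; apply/eqP; apply: eq_bigr => j _; rewrite aE !mxE /=; ring.
have key k : v k 0 * (M *m v) k 0 * (u k 0 ^+ 2 + v k 0 ^+ 2) = - v k 0 ^+ 2.
  have := ra k; rewrite aE MaE => /eqP; rewrite eq_complex /=.
  move=> /andP[/eqP re /eqP im].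
  have e1 : v k 0 * (M *m v) k 0 = u k 0 * (M *m u) k 0 - 1 by rewrite -re; ring.
  have e2 : u k 0 * (M *m v) k 0 = - (v k 0 * (M *m u) k 0).
    by apply/eqP; rewrite -subr_eq0 opprK im.
  rewrite mulrDr [X in _ + X]mulrC {2}e1.
  transitivity (v k 0 * u k 0 * (u k 0 * (M *m v) k 0) +
     v k 0 ^+ 2 * (u k 0 * (M *m u) k 0 - 1)); first by ring.
  by rewrite e2; ring.
have vq k : v k 0 * (M *m v) k 0 <= 0.
  have [d0|d0] := eqVneq (u k 0 ^+ 2 + v k 0 ^+ 2) 0.
    have v0 : v k 0 = 0.
      move/eqP: d0; rewrite paddr_eq0 ?sqr_ge0 // => /andP[_].
      by rewrite sqrf_eq0 => /eqP.
    by rewrite v0 mul0r.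
  have dp : 0 < u k 0 ^+ 2 + v k 0 ^+ 2 by rewrite lt0r d0 addr_ge0 ?sqr_ge0.
  by rewrite -(pmulr_lle0 _ dp) key oppr_le0 sqr_ge0.
have v0 k : v k 0 = 0.
  have : - qform M v == 0.
    rewrite eq_le oppr_le0 M0 /= /qform -sumrN; apply: sumr_ge0 => j _.
    by rewrite oppr_ge0.
  rewrite /qform -sumrN psumr_eq0 => [/allP/(_ k)|j _]; last by rewrite oppr_ge0.
  rewrite mem_index_enum oppr_eq0 => /(_ isT)/eqP vq0.
  by have /esym/eqP := key k; rewrite vq0 mul0r oppr_eq0 sqrf_eq0 => /eqP.
by apply/colP => k; rewrite aE v0 !mxE.
Qed.

(** * Existence of a positive inverse eigenvector *)

Lemma poly_min_deriv0 {R : realType} (p : {poly R}) (d : R) : 0 < d ->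
  (forall t, `|t| < d -> p.[0] <= p.[t]) -> p^`().[0] = 0.
Proof.
move=> d0 pmin; rewrite derivE derive1E.
have D : is_derive (0 : R) 1 (horner p) 0.
  apply: (@derive1_at_min R _ (- d) d); first by rewrite ge0_cp // ltW.
  - by move=> t _; exact: derivable_horner.
  - by rewrite in_itv /= oppr_lt0 d0.
  - by move=> t; rewrite in_itv /= -ltr_norml; exact: pmin.
exact: derive_val.
Qed.

Lemma qform_shift {K : comNzRingType} {n} (M : 'M[K]_n) (x : 'cV[K]_n) t k :
  M^T = M ->
  qform M (x + t *: delta_mx k 0) =
  qform M x + t *+ 2 * (M *m x) k 0 + t ^+ 2 * M k k.
Proof.
move=> symM; rewrite -!qformE.
have dM : (delta_mx k 0 : 'cV[K]_n)^T *m M = row k M by rewrite trmx_delta -rowE.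
have e1 : ((delta_mx k 0 : 'cV[K]_n)^T *m M *m x) 0 0 = (M *m x) k 0.
  by rewrite dM -row_mul mxE.
have e2 : (x^T *m M *m (delta_mx k 0 : 'cV[K]_n)) 0 0 = (M *m x) k 0.
  by rewrite -e1 -[in LHS](trmxK (x^T *m M *m _)) mxE !trmx_mul symM trmxK mulmxA.
have e3 : ((delta_mx k 0 : 'cV[K]_n)^T *m M *m (delta_mx k 0 : 'cV[K]_n)) 0 0
          = M k k.
  by rewrite dM -colE !mxE.
have -> : (x + t *: delta_mx k 0)^T = x^T + t *: (delta_mx k 0 : 'cV[K]_n)^T.
  by apply/matrixP => i j; rewrite !mxE.
rewrite !(mulmxDl, mulmxDr) -!(scalemxAl, scalemxAr).
have DE (A B : 'M[K]_1) : (A + B) 0 0 = A 0 0 + B 0 0 by rewrite mxE.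
have ZE (A : 'M[K]_1) : (t *: A) 0 0 = t * A 0 0 by rewrite mxE.
by rewrite !(DE, ZE) e1 e2 e3; ring.
Qed.

Lemma qformZ {K : comNzRingType} {n} (M : 'M[K]_n) (x : 'cV[K]_n) t :
  qform M (t *: x) = t ^+ 2 * qform M x.
Proof.
rewrite /qform mulr_sumr; apply: eq_bigr => k _.
by rewrite -scalemxAr !mxE; ring.
Qed.

Lemma continuous_mul_coord {R : realType} {n} (M : 'M[R]_n) k :
  continuous (fun v : 'rV[R]_n => v 0 k * (M *m v^T) k 0).
Proof.
have -> : (fun v : 'rV[R]_n => v 0 k * (M *m v^T) k 0) =
    (fun v => v 0 k * \sum_j M k j * v 0 j).
  apply/funext => v; rewrite mxE; congr (_ * _); apply: eq_bigr => j _.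
  by rewrite mxE.
move=> v; apply: continuousM; first exact: coord_continuous.
move: v; apply: continuous_big; first exact: add_continuous.
move=> j _ v.
by apply: continuousM; [exact: cst_continuous|exact: coord_continuous].
Qed.

Lemma continuous_qform {R : realType} {n} (M : 'M[R]_n) :
  continuous (fun v : 'rV[R]_n => qform M v^T).
Proof.
have -> : (fun v : 'rV[R]_n => qform M v^T) =
    (fun v => \sum_k v 0 k * (M *m v^T) k 0).
  by apply/funext => v; apply: eq_bigr => k _; rewrite [v^T k 0]mxE.
apply: continuous_big; first exact: add_continuous.
by move=> k _; exact: continuous_mul_coord.
Qed.

(** The vector [c] maximizes the product of the coordinates on the compact set
    of nonnegative [x] with [x^T M x <= 1]; the inequality for [y] comes from
    rescaling [y] into this set.  Squares keep both sides polynomial in [y]. *)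
Lemma max_in_orthant {R : realType} {n} (M : 'M[R]_n.+1) (e : R) : 0 < e ->
  (forall x : 'cV[R]_n.+1, e * \sum_k x k 0 ^+ 2 <= qform M x) ->
  exists c : 'cV[R]_n.+1, [/\ forall k, 0 <= c k 0, qform M c <= 1 &
    forall y : 'cV[R]_n.+1, (forall k, 0 < y k 0) ->
      (\prod_k y k 0) ^+ 2 <= (\prod_k c k 0) ^+ 2 * qform M y ^+ n.+1].
Proof.
move=> e0 Me.
(* [x_k ^ 2 <= e^-1] implies [x_k <= e^-1 + 1], whether or not [e^-1 <= 1]. *)
pose B := e^-1 + 1.
pose K := [set v : 'rV[R]_n.+1 | forall i, v ord0 i \in `[0, B]] `&`
          [set x : 'rV[R]_n.+1 | qform M x^T <= 1].
have K_compact : compact K.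
  apply: compact_closedI.
    apply: (@rV_compact _  _ (fun=> `[0, B]%classic)).
    by move=> _; apply: segment_compact.
  have /continuous_closedP := @continuous_qform R n.+1 M.
  by move=> /(_ _ (@closed_le R 1)).
have in_K (x : 'rV[R]_n.+1) : (forall k, 0 <= x 0 k) -> qform M x^T <= 1 -> K x.
  move=> x0 qx; split=> //= k; rewrite in_itv /= x0 /=.
  have : x 0 k ^+ 2 <= e^-1.
    rewrite -[leRHS]mul1r ler_pdivlMr // mulrC; apply: le_trans qx.
    apply: le_trans (Me _); rewrite ler_pM2l // (bigD1 k) //= mxE lerDl.
    by apply: sumr_ge0 => j _; rewrite sqr_ge0.
  have ei : 0 < e^-1 by rewrite invr_gt0.
  by rewrite /B; nra.
have K0 : K !=set0.
  exists 0; apply: in_K => [k|]; first by rewrite mxE.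
  by rewrite /qform big1 ?ler01 // => k _; rewrite !mxE mul0r.
have pc : continuous (fun x : 'rV[R]_n.+1 => \prod_k x 0 k).
  apply: continuous_big; first exact: mul_continuous.
  by move=> k _; exact: coord_continuous.
have [c /set_mem[cB cq] cmax] := EVT_max_rV K0 K_compact (continuous_subspaceT pc).
exists c^T; split=> // [k|y y0].
  by have := cB k; rewrite mxE in_itv /= => /andP[].
have q0 : 0 < qform M y.
  apply: lt_le_trans (Me y); rewrite mulr_gt0 // (bigD1 ord0) //=.
  by rewrite ltr_pwDl ?exprn_gt0 // sumr_ge0 // => j _; rewrite sqr_ge0.
pose s := Num.sqrt (qform M y).
have s0 : 0 < s by rewrite sqrtr_gt0.
have s2 : s ^+ 2 = qform M y by rewrite sqr_sqrtr // ltW.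
have : \prod_k (s^-1 *: y^T) 0 k <= \prod_k c 0 k.
  apply/cmax/mem_set/in_K => [k|].
    by rewrite !mxE mulr_ge0 ?invr_ge0 ?ltW.
  by rewrite linearZ /= trmxK qformZ -s2 exprVn mulVf // expf_neq0 // gt_eqF.
under eq_bigr do rewrite !mxE.
rewrite big_split /= prodr_const card_ord => le_c.
have -> : \prod_k c^T k 0 = \prod_k c 0 k by apply: eq_bigr => k _; rewrite mxE.
have yp : 0 <= \prod_k y k 0 by apply: prodr_ge0 => k _; exact: ltW.
rewrite -s2 -exprM mulnC exprM -exprMn lerXn2r ?nnegrE //.
  apply: mulr_ge0; last by rewrite exprn_ge0 // ltW.
  apply: prodr_ge0 => k _.
  by have := cB k; rewrite in_itv /= => /andP[].
rewrite -ler_pdivrMr ?exprn_gt0 // mulrC -exprVn.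
by [].
Qed.

(** Moving the maximizer [c] of [max_in_orthant] by [t] along the [k]-th axis
    gives a polynomial in [t] with a local minimum at [0].  Its derivative
    vanishes there, which reads [c_k (M c)_k = 1 / n], and it remains to
    multiply [c] by the square root of [n]. *)
Lemma pos_inveig_exists {R : realType} {n} (M : 'M[R]_n) (e : R) :
  M^T = M -> 0 < e ->
  (forall x : 'cV[R]_n, e * \sum_k x k 0 ^+ 2 <= qform M x) ->
  exists2 a, inverse_eigenvector M a & forall k, 0 < a k 0.
Proof.
case: n M => [|n] M symM e0 Me; first by exists 0 => [] [].
have [c [c0 qc1 cmax]] := max_in_orthant M e e0 Me.
set P := \prod_k c k 0 in cmax.
have P0 : 0 < P ^+ 2.
  have : forall k, 0 < (const_mx 1 : 'cV[R]_n.+1) k 0 by move=> k; rewrite mxE.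
  move=> /cmax; rewrite big1 => [|k _]; last by rewrite mxE.
  rewrite expr1n lt_neqAle sqr_ge0 andbT; apply: contraTneq => <-.
  by rewrite mul0r -ltNge ltr01.
have cp k : 0 < c k 0.
  rewrite lt_neqAle c0 andbT; apply: contraTneq P0 => ck.
  by rewrite /P (bigD1 k) //= -ck mul0r expr0n ltxx.
(* The inequality for [y = c] itself shows that the constraint is tight. *)
have q1 : qform M c = 1.
  apply/eqP; rewrite eq_le qc1 /=.
  have := cmax c cp; rewrite -[leLHS]mulr1 ler_pM2l // => qn.
  have q0 : 0 <= qform M c.
    apply: le_trans (Me c); rewrite mulr_ge0 ?(ltW e0) // sumr_ge0 // => j _.
    by rewrite sqr_ge0.
  by rewrite leNgt; apply: contraTN qn => qlt; rewrite -ltNge exprn_ilt1.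
have Mc k : c k 0 * (M *m c) k 0 = n.+1%:R^-1.
  set b := (M *m c) k 0; set x := c k 0; set m := M k k.
  pose p : {poly R} := (1 + 'X * (b *+ 2)%:P + 'X * 'X * m%:P) ^+ n.+1
                       - (1 + 'X * x^-1%:P) ^+ 2.
  have pE t : p.[t] = (1 + t *+ 2 * b + t ^+ 2 * m) ^+ n.+1 - (1 + t / x) ^+ 2.
    rewrite /p !(hornerE, horner_exp).
    by congr (_ ^+ _ - _ ^+ 2); ring.
  have : p^`().[0] = 0.
    apply: (@poly_min_deriv0 R p x (cp k)) => t tx.
    rewrite !pE mul0rn expr0n /= !mul0r !addr0 !expr1n subrr subr_ge0.
    have := cmax (c + t *: delta_mx k 0); rewrite qform_shift // q1 -/b -/m.
    rewrite (_ : \prod_k _ = P * (1 + t / x)); last first.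
      rewrite /P (bigD1 k) //= [in RHS](bigD1 k) //= !mxE !eqxx mulr1.
      rewrite mulrAC mulrDr mulr1 mulrCA mulfV ?gt_eqF // mulr1; congr (_ * _).
      by apply: eq_bigr => j jk; rewrite !mxE (negPf jk) mulr0 addr0.
    rewrite exprMn ler_pM2l //; apply => j; rewrite !mxE andbT.
    have [->|_] := eqVneq j k; last by rewrite mulr0 addr0.
    by rewrite mulr1 -/x; move: tx; rewrite ltr_norml => /andP[]; lra.
  have p'E : p^`().[0] = n.+1%:R * (b *+ 2) - x^-1 *+ 2.
    rewrite /p derivB !deriv_exp !(derivD, derivM, derivX, derivC).
    rewrite !(hornerE, horner_exp).
    rewrite !hornerMn !(hornerE, horner_exp).
    by rewrite expr1n mulr1 -[LHS]/(_ - _ *+ 2) -[in LHS]mulr_natl.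
  rewrite p'E mulrnAr -mulrnBl => /eqP; rewrite mulrn_eq0 /= subr_eq0 => /eqP nb.
  have x0 : x != 0 by rewrite gt_eqF ?cp.
  have N0 : n.+1%:R != 0 :> R by rewrite pnatr_eq0.
  by apply: (mulfI N0); rewrite mulrCA nb !mulfV.
exists (Num.sqrt n.+1%:R *: c) => k; last by rewrite mxE mulr_gt0 ?sqrtr_gt0 ?ltr0n.
transitivity (Num.sqrt n.+1%:R * c k 0 * (Num.sqrt n.+1%:R * (M *m c) k 0)).
  by rewrite -scalemxAr !mxE.
by rewrite mulrACA Mc -expr2 sqr_sqrtr ?ler0n // mulfV // pnatr_eq0.
Qed.

(** * Regularized matrices and limits of their inverse eigenvectors *)

Definition in_orthant {R : numDomainType} {n} (s : {set 'I_n}) (a : 'cV[R]_n) :=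
  forall k, 0 < (-1) ^+ (k \in s) * a k 0.

Definition neg_coords {R : numDomainType} {n} (a : 'cV[R]_n) : {set 'I_n} :=
  [set k | a k 0 < 0]%SET.

Lemma in_neg_coords {R : realDomainType} {n} (a : 'cV[R]_n) :
  (forall k, a k 0 != 0) -> in_orthant (neg_coords a) a.
Proof.
move=> a0 k; rewrite inE; have [ak|ak|ak] := ltgtP (a k 0) 0.
- by rewrite expr1 mulN1r oppr_gt0.
- by rewrite expr0 mul1r.
- by have := a0 k; rewrite ak eqxx.
Qed.

Lemma orthant_inj {R : realDomainType} {n} (s t : {set 'I_n}) (a : 'cV[R]_n) :
  in_orthant s a -> in_orthant t a -> s = t.
Proof.
move=> sa ta; apply/setP => k; have := sa k; have := ta k.
case: (k \in s); case: (k \in t) => //=;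
  rewrite !(expr0, expr1, mul1r, mulN1r); lra.
Qed.

Lemma orthant_mul_gt0 {R : realDomainType} {n} (s : {set 'I_n}) (a b : 'cV[R]_n) :
  in_orthant s a -> in_orthant s b -> forall k, 0 < a k 0 * b k 0.
Proof.
move=> sa sb k; have := mulr_gt0 (sa k) (sb k).
by rewrite mulrACA -expr2 sqrr_sign mul1r.
Qed.

(** Changing the signs of the coordinates in [s] reduces to the positive
    orthant. *)
Lemma orthant_inveig_exists {R : realType} {n} (M : 'M[R]_n) (e : R)
    (s : {set 'I_n}) :
  M^T = M -> 0 < e ->
  (forall x : 'cV[R]_n, e * \sum_k x k 0 ^+ 2 <= qform M x) ->
  exists2 a, inverse_eigenvector M a & in_orthant s a.
Proof.
move=> symM e0 Me.
pose sg : 'cV[R]_n := \col_k (-1) ^+ (k \in s).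
pose D := diag_mx sg^T.
have Dk (x : 'cV[R]_n) k : (D *m x) k 0 = sg k 0 * x k 0.
  by rewrite mul_diag_mx !mxE.
have sg2 k : sg k 0 * sg k 0 = 1 by rewrite !mxE -expr2 sqrr_sign.
have [||c rc c0] := @pos_inveig_exists R n (D *m M *m D) e _ e0.
- by rewrite !trmx_mul !tr_diag_mx symM mulmxA.
- move=> x; rewrite (_ : qform _ x = qform M (D *m x)); last first.
    by rewrite -!qformE !trmx_mul tr_diag_mx !mulmxA.
  apply: le_trans (Me _); rewrite ler_pM2l //; apply: ler_sum => k _.
  by rewrite Dk exprMn [sg k 0 ^+ 2]expr2 sg2 mul1r.
exists (D *m c) => k.
  by have := rc k; rewrite -!mulmxA Dk Dk mulrCA mulrA.
by rewrite Dk mxE mulrA -expr2 sqrr_sign mul1r.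
Qed.

Lemma qform_addM {K : comNzRingType} {n} (M : 'M[K]_n) (e : K) (x : 'cV[K]_n) :
  qform (M + e%:M) x = qform M x + e * \sum_k x k 0 ^+ 2.
Proof.
rewrite /qform mulr_sumr -big_split; apply: eq_bigr => k _ /=.
by rewrite mulmxDl mul_scalar_mx !mxE; ring.
Qed.

(** The matrix [M + e] is positive definite, so no orthant is empty. *)
Lemma regularized_inveig {R : realType} {n} (M : 'M[R]_n) (e : R) :
  M^T = M -> psd M -> 0 < e ->
  exists r : {set 'I_n} -> 'cV[R]_n,
  [/\ forall s, inverse_eigenvector (M + e%:M) (r s),
      forall s, in_orthant s (r s),
      forall s, 0 < weight (M + e%:M) (r s) &
      forall S T, principal_minor (M + e%:M) T *
        (\sum_s weight (M + e%:M) (r s) * (monomial (r s) S * monomial (r s) T))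
        = (S == T)%:R].
Proof.
move=> symM M0 e0.
have /boolp.choice[r rP] (s : {set 'I_n}) :
    exists a : 'cV[R]_n, inverse_eigenvector (M + e%:M) a /\ in_orthant s a.
  have [||a ra sa] := @orthant_inveig_exists R n (M + e%:M) e s _ e0.
  - by rewrite raddfD /= symM tr_scalar_mx.
  - by move=> x; rewrite qform_addM lerDr.
  by exists a.
have gp s : 0 < bezoutian (M + e%:M) (r s) (r s).
  apply: bezoutian_gt0 => [x|k]; last by case: (rP s) => /inveig_neq0.
  rewrite qform_addM addr_ge0 // mulr_ge0 ?(ltW e0) //.
  by apply: sumr_ge0 => k _; exact: sqr_ge0.
exists r; split=> [s|s|s|].
- by case: (rP s).
- by case: (rP s).
- by rewrite weight_bezoutian ?invr_gt0 // => k; case: (rP s) => /inveig_neq0.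
apply: moments_all_orthants => [s t rst|s|s]; last by rewrite gt_eqF.
  apply: (@orthant_inj _ _ _ _ (r s)); first by case: (rP s).
  by rewrite rst; case: (rP t).
by case: (rP s).
Qed.

(** A cluster point of the sequence satisfies the equations for [M] by
    continuity and lies in the closed orthant; its coordinates are nonzero
    because they solve the equations. *)
Lemma bounded_inveig_limit {R : realType} {n} (M : 'M[R]_n) (s : {set 'I_n})
    (y : nat -> 'cV[R]_n) (e : nat -> R) (B : R) :
  (forall j, 0 <= e j) -> e @ \oo --> (0 : R) ->
  (forall j, inverse_eigenvector (M + (e j)%:M) (y j)) ->
  (forall j, in_orthant s (y j)) ->
  (forall j k, `|y j k 0| <= B) ->
  exists2 a, inverse_eigenvector M a & in_orthant s a.
Proof.
move=> e0 ecvg ry sy yB.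
pose F := (fun j => (y j)^T) @ \oo.
have box : compact [set v : 'rV[R]_n | forall i, v ord0 i \in `[- B, B]].
  apply: (@rV_compact _  _ (fun=> `[- B, B]%classic)).
  by move=> _; apply: segment_compact.
have [|p [_ pF]] := box F.
  by exists 0%N => // j _ i; rewrite mxE in_itv /= -ler_norml.
have inF (C : set 'rV[R]_n) : closed C -> F C -> C p.
  by move=> cC FC; apply: cC => U pU; exact: pF.
have rp : inverse_eigenvector M p^T.
  move=> k; rewrite mxE; apply/eqP; rewrite -subr_eq0 -normr_le0.
  apply/ler_addgt0Pr => d d0; rewrite add0r.
  have ncont : continuous (fun v : 'rV[R]_n => `|v 0 k * (M *m v^T) k 0 - 1|).
    move=> v; apply: (@continuous_comp _ _ _
      (fun v : 'rV[R]_n => v 0 k * (M *m v^T) k 0 - 1) (fun x : R => `|x|) v).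
      by apply: continuousB; [exact: continuous_mul_coord|exact: cst_continuous].
    exact: norm_continuous.
  have /continuous_closedP/(_ _ (@closed_le R d)) := ncont.
  move=> /inF; apply.
  have : (fun j => e j * B ^+ 2) @ \oo --> (0 * B ^+ 2 : R).
    by apply: cvgM => //; exact: cvg_cst.
  rewrite mul0r => /cvgrPdist_le/(_ _ d0); apply: filterS => j /=.
  rewrite sub0r normrN => eB.
  have -> : (y j)^T 0 k * (M *m (y j)^T^T) k 0 - 1 = - (e j * y j k 0 ^+ 2).
    rewrite -(ry j k) trmxK mulmxDl mul_scalar_mx !mxE; ring.
  rewrite normrN; apply: le_trans eB; rewrite normrM [leRHS]normrM ler_wpM2l //.
  by rewrite !normrX lerXn2r ?nnegrE // (le_trans (yB j k)) ?ler_norm.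
exists p^T => // k; rewrite lt_neqAle; apply/andP; split.
  by rewrite eq_sym mulf_neq0 ?signr_eq0 //; exact: inveig_neq0.
have sc : continuous (fun v : 'rV[R]_n => (-1) ^+ (k \in s) * v 0 k).
  move: (_ ^+ _) => c v.
  by apply: continuousM; [exact: cst_continuous|exact: coord_continuous].
have /continuous_closedP/(_ _ (@closed_ge R 0)) := sc.
rewrite mxE => /inF; apply.
by exists 0%N => // j _ /=; rewrite mxE ltW //; exact: sy.
Qed.

Lemma cvg_det {R : realType} {n} (A : nat -> 'M[R]_n) (L : 'M[R]_n) :
  (forall i j, (fun m => A m i j) @ \oo --> L i j) ->
  (fun m => \det (A m)) @ \oo --> \det L.
Proof.
move=> AL; apply: cvg_big => [|s _]; first exact: add_continuous.
apply: cvgM; first exact: cvg_cst.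
by apply: cvg_big => //; exact: mul_continuous.
Qed.

Lemma cvg_add_scalar_mx {R : realType} {n} (M : 'M[R]_n) (e : nat -> R) i j :
  e @ \oo --> (0 : R) -> (fun m => (M + (e m)%:M) i j) @ \oo --> M i j.
Proof.
move=> e0; under eq_fun do rewrite !mxE -mulr_natr.
have : (fun m => M i j + e m * (i == j)%:R) @ \oo --> (M i j + 0 * (i == j)%:R : R).
  by apply: cvgD; [exact: cvg_cst|apply: cvgM => //; exact: cvg_cst].
by rewrite mul0r addr0.
Qed.

Lemma cvg_principal_minor {R : realType} {n} (M : 'M[R]_n) (e : nat -> R) S :
  e @ \oo --> (0 : R) ->
  (fun m => principal_minor (M + (e m)%:M) S) @ \oo --> principal_minor M S.
Proof.
move=> e0; apply: cvg_det => i j; under eq_fun do rewrite mxE; rewrite mxE.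
by case: ifP => _; [exact: cvg_add_scalar_mx|exact: cvg_cst].
Qed.

Lemma cvg_monomial {R : realType} {n} (b : nat -> 'cV[R]_n) (a : 'cV[R]_n) S :
  (forall k, (fun m => b m k 0) @ \oo --> a k 0) ->
  (fun m => monomial (b m) S) @ \oo --> monomial a S.
Proof. by move=> ba; apply: cvg_big => //; exact: mul_continuous. Qed.

Lemma cvg_weight {R : realType} {n} (M : 'M[R]_n) (e : nat -> R)
    (b : nat -> 'cV[R]_n) (a : 'cV[R]_n) :
  psd M -> (forall k, a k 0 != 0) ->
  (forall m k, b m k 0 != 0) -> e @ \oo --> (0 : R) ->
  (forall k, (fun m => b m k 0) @ \oo --> a k 0) ->
  (fun m => weight (M + (e m)%:M) (b m)) @ \oo --> weight M a.
Proof.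
move=> M0 a0 b0 e0 ba; rewrite weight_bezoutian //.
under eq_fun do rewrite weight_bezoutian //.
apply: cvgV; first by rewrite gt_eqF // bezoutian_gt0.
apply: cvg_big => [|S _]; first exact: add_continuous.
by apply: cvgM; [exact: cvg_principal_minor|apply: cvgM; exact: cvg_monomial].
Qed.

Lemma cvg_inveig {R : realType} {n} (M : 'M[R]_n) (e : nat -> R)
    (b : nat -> 'cV[R]_n) (a : 'cV[R]_n) :
  psd M -> (forall m, 0 < e m) -> e @ \oo --> (0 : R) ->
  (forall m, inverse_eigenvector (M + (e m)%:M) (b m)) ->
  inverse_eigenvector M a ->
  (forall m k, 0 < a k 0 * b m k 0) ->
  forall k, (fun m => b m k 0) @ \oo --> a k 0.
Proof.
move=> M0 ep e0 rb ra ab k; apply/cvgrPdist_le => d d0.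
set N := (\sum_j a j 0 ^+ 2) ^+ 2.
have : (fun j => e j * N) @ \oo --> (0 * N : R).
  by apply: cvgM => //; exact: cvg_cst.
have d2 : 0 < d ^+ 2 by rewrite exprn_gt0.
rewrite mul0r => /cvgrPdist_le/(_ _ d2); apply: filterS => m /=.
have eN0 : 0 <= e m * N by apply: mulr_ge0; [exact: ltW|exact: sqr_ge0].
rewrite sub0r normrN ger0_norm // => eN.
have := inveig_close M (e m) a (b m) M0 ra (rb m) (ep m) (ab m) k.
move=> /le_trans/(_ eN); rewrite distrC -(real_normK (num_real (b m k 0 - a k 0))).
by rewrite distrC ler_pXn2r ?nnegrE ?(ltW d0).
Qed.

(** * Moments in the semidefinite case *)

(** If infinitely many [w m] were larger than some [d > 0], the bound on
    [w m * b m k 0 ^+ 2] would make the corresponding [b m] bounded, and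
    [bounded_inveig_limit] would produce an inverse eigenvector of [M] in the
    orthant. *)
Lemma empty_orthant_weight_cvg0 {R : realType} {n} (M : 'M[R]_n) (s : {set 'I_n})
    (e : nat -> R) (b : nat -> 'cV[R]_n) (w : nat -> R) (c : 'I_n -> R) :
  (forall a, inverse_eigenvector M a -> ~ in_orthant s a) ->
  (forall m, 0 < e m) -> e @ \oo --> (0 : R) ->
  (forall m, inverse_eigenvector (M + (e m)%:M) (b m)) ->
  (forall m, in_orthant s (b m)) ->
  (forall m, 0 < w m) -> (forall m k, w m * b m k 0 ^+ 2 <= c k) ->
  w @ \oo --> (0 : R).
Proof.
move=> empty_s ep e0 rb sb wp wc; apply/cvgrPdist_le => d d0; apply: contrapT => nw.
have /boolp.choice[j jP] (N : nat) : exists j, (N <= j)%N /\ d < w j.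
  apply: contrapT => nj; apply: nw; exists N => // m /= Nm.
  rewrite sub0r normrN gtr0_norm // leNgt; apply/negP => dw.
  by apply: nj; exists m.
have c0 k : 0 <= c k.
  by apply: le_trans (wc 0%N k); rewrite mulr_ge0 ?sqr_ge0 ?(ltW (wp _)).
have [|||||a ra sa] := @bounded_inveig_limit R n M s (b \o j) (e \o j)
  (1 + \sum_k c k / d).
- by move=> N; exact: (ltW (ep (j N))).
- apply/cvgrPdist_le => h h0; move/cvgrPdist_le: e0 => /(_ _ h0)[N _ eN].
  by exists N => // m /= Nm; apply: eN => /=; case: (jP m) => /(leq_trans Nm).
- by move=> N; exact: rb.
- by move=> N; exact: sb.
- move=> N k /=; set x := b (j N) k 0.
  have : x ^+ 2 <= c k / d.
    rewrite ler_pdivlMr // mulrC; apply: le_trans (wc (j N) k).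
    by rewrite ler_wpM2r ?sqr_ge0 // ltW; case: (jP N).
  have : c k / d <= \sum_k c k / d.
    rewrite [leRHS](bigD1 k) //= lerDl; apply: sumr_ge0 => i _.
    by rewrite divr_ge0 // ltW.
  rewrite -[x ^+ 2]real_normK ?num_real //; have := normr_ge0 x.
  by move: `|x| (c k / d) (\sum_k _) => X Y Z; nra.
exact: empty_s ra sa.
Qed.

(** Multiplying the [l]-th equation by [w m] bounds
    [M l l * (w m * b m l 0 ^+ 2)] by [w m] plus a combination of the
    [w m * |b m l 0 * b m k 0|] with [k != l], each of which is at most the
    square root of [w m * q k]. *)
Lemma escaping_moment_cvg0 {R : realType} {n} (M : 'M[R]_n)
    (e : nat -> R) (b : nat -> 'cV[R]_n) (w : nat -> R) (q : 'I_n -> R)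
    (l : 'I_n) :
  0 < M l l -> (forall m, 0 < e m) ->
  (forall m, inverse_eigenvector (M + (e m)%:M) (b m)) ->
  (forall m, 0 < w m) -> w @ \oo --> (0 : R) ->
  (forall m k, k != l -> w m * (b m l 0 * b m k 0) ^+ 2 <= q k) ->
  (fun m => w m * b m l 0 ^+ 2) @ \oo --> (0 : R).
Proof.
move=> Ml ep rb wp w0 wq.
(* [Phi (w m)] is the upper bound described above, as a continuous function of
   the weight that vanishes at [0]. *)
pose Phi x := (x + \sum_(k | k != l) `|M l k| * Num.sqrt (x * q k)) / M l l.
have Phi0 : (fun m => Phi (w m)) @ \oo --> (0 : R).
  have -> : 0 = Phi 0.
    by rewrite /Phi big1 ?addr0 ?mul0r // => k _; rewrite mul0r sqrtr0 mulr0.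
  apply: cvgM; last exact: cvg_cst.
  apply: cvgD => //; apply: cvg_big => [|k _]; first exact: add_continuous.
  apply: cvgM; first exact: cvg_cst.
  apply: (@cvg_comp _ _ _ (fun m => w m * q k) Num.sqrt _ (nbhs (0 * q k))).
    by apply: cvgM => //; exact: cvg_cst.
  exact: sqrt_continuous.
apply: (squeeze_cvgr _ (cvg_cst 0) Phi0); apply: nearW => m.
have [wm em] := (wp m, ep m); rewrite mulr_ge0 ?sqr_ge0 ?(ltW wm) //=.
rewrite /Phi ler_pdivlMr //.
have := rb m l; rewrite mulmxDl mul_scalar_mx !mxE (bigD1 l) //=.
set x := b m l 0; set T := \sum_(_ < _ | _) _ => eq1.
have -> : w m * x ^+ 2 * M l l = w m - w m * (e m * x ^+ 2) - w m * (x * T).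
  by rewrite -[X in _ = X - _ - _]mulr1 -eq1; ring.
have occupied : 0 <= w m * (e m * x ^+ 2).
  by apply: mulr_ge0; [exact: ltW|apply: mulr_ge0; [exact: ltW|exact: sqr_ge0]].
suff : `|w m * (x * T)| <= \sum_(k < n | k != l) `|M l k| * Num.sqrt (w m * q k).
  by rewrite ler_norml => /andP[]; lra.
rewrite /T !mulr_sumr; apply: le_trans (ler_norm_sum _ _ _) _.
apply: ler_sum => k kl.
rewrite (_ : w m * _ = M l k * (w m * (x * b m k 0))); last by ring.
rewrite normrM ler_wpM2l // -sqrtr_sqr ler_wsqrtr // exprMn expr2 -mulrA.
rewrite ler_wpM2l ?(ltW wm) //.
exact: wq.
Qed.

Lemma principal_minor1_add {K : comNzRingType} {n} (M : 'M[K]_n) e k :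
  principal_minor (M + e%:M) [set k]%SET = M k k + e.
Proof. by rewrite principal_minor1 !mxE eqxx mulr1n. Qed.

Lemma principal_minor2_add {K : comNzRingType} {n} (M : 'M[K]_n) e k l : k != l ->
  principal_minor (M + e%:M) [set k; l]%SET =
  (M k k + e) * (M l l + e) - M k l * M l k.
Proof.
move=> kl; rewrite principal_minor2 // !mxE !eqxx [l == k]eq_sym (negPf kl).
by rewrite !mulr1n !mulr0n !addr0.
Qed.

Lemma monomial0 {K : comNzRingType} {n} (a : 'cV[K]_n) :
  monomial a finset.set0 = 1.
Proof. by rewrite /monomial big_set0. Qed.

Lemma monomial1 {K : comNzRingType} {n} (a : 'cV[K]_n) k :
  monomial a [set k]%SET = a k 0.
Proof. by rewrite /monomial big_set1. Qed.

Lemma monomial2 {K : comNzRingType} {n} (a : 'cV[K]_n) k l : k != l ->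
  monomial a [set k; l]%SET = a k 0 * a l 0.
Proof. by move=> kl; rewrite /monomial big_setU1 ?inE //= big_set1. Qed.

Lemma card_le1P {T : finType} (S : {set T}) :
  (#|S| <= 1)%N -> S = finset.set0 \/ exists k, S = [set k]%SET.
Proof.
rewrite leq_eqVlt ltnS leqn0 cards_eq0 => /orP[/cards1P[k ->]|/eqP ->].
  by right; exists k.
by left.
Qed.

(** This is the limit for [e] tending to [0] of the identity for [M + e] in
    [regularized_inveig].  The orthants that are not [occupied] drop out because
    the sets have at most one element; for larger sets, what escapes to infinity
    in these orthants can contribute to the limit. *)
Lemma low_moments {R : realType} {n} (M : 'M[R]_n)
    (occupied : pred {set 'I_n}) (a : {set 'I_n} -> 'cV[R]_n) :
  M^T = M -> psd M -> (forall k, 0 < M k k) ->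
  (forall k l, k != l -> M k l ^+ 2 < M k k * M l l) ->
  (forall s, occupied s -> inverse_eigenvector M (a s) /\ in_orthant s (a s)) ->
  (forall s x, inverse_eigenvector M x -> in_orthant s x -> occupied s) ->
  forall S T : {set 'I_n}, (#|S| <= 1)%N -> (#|T| <= 1)%N ->
  principal_minor M T *
    (\sum_(s | occupied s) weight M (a s) * (monomial (a s) S * monomial (a s) T))
  = (S == T)%:R.
Proof.
move=> symM M0 M1 M2 occupiedP occupied_inveig S T S1 T1.
pose e (m : nat) : R := m.+1%:R^-1.
have ep m : 0 < e m by rewrite invr_gt0 ltr0n.
have e0 : e @ \oo --> (0 : R) := @cvg_harmonic R.
have /boolp.choice[b bP] m := regularized_inveig M (e m) symM M0 (ep m).
pose w m s := weight (M + (e m)%:M) (b m s).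
have rb m s : inverse_eigenvector (M + (e m)%:M) (b m s) by case: (bP m).
have sb m s : in_orthant s (b m s) by case: (bP m).
have wp m s : 0 < w m s by have [_ _ H _] := bP m; exact: H.
(* A single term of the sum in the exact identity for [M + e m] is at most the
   whole sum. *)
have bound m s U : 0 < principal_minor (M + (e m)%:M) U ->
    w m s * monomial (b m s) U ^+ 2 <= (principal_minor (M + (e m)%:M) U)^-1.
  move=> pU; have [_ _ _ /(_ U U)] := bP m; rewrite eqxx => E.
  have p0 : principal_minor (M + (e m)%:M) U != 0 by rewrite gt_eqF.
  rewrite -[leRHS](mulKf p0) mulfV // -[X in _ <= _ * X]E mulKf //.
  rewrite [leRHS](bigD1 s) //= -expr2 lerDl; apply: sumr_ge0 => t _.
  by rewrite -expr2 mulr_ge0 ?sqr_ge0 // ltW // wp.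
have bound1 m s k : w m s * b m s k 0 ^+ 2 <= (M k k)^-1.
  have p0 : 0 < principal_minor (M + (e m)%:M) [set k]%SET.
    by rewrite principal_minor1_add addr_gt0.
  have := bound m s _ p0; rewrite monomial1 => /le_trans; apply.
  by rewrite principal_minor1_add lef_pV2 ?posrE ?addr_gt0 // lerDl ltW.
have bound2 m s l k : k != l ->
    w m s * (b m s l 0 * b m s k 0) ^+ 2 <= (M k k * M l l - M k l ^+ 2)^-1.
  move=> kl.
  have d0 : 0 < M k k * M l l - M k l ^+ 2 by rewrite subr_gt0 M2.
  have lk : M l k = M k l by rewrite -[in LHS]symM mxE.
  have de : M k k * M l l - M k l ^+ 2 <=
      principal_minor (M + (e m)%:M) [set k; l]%SET.
    rewrite principal_minor2_add // lk -expr2 lerD2r.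
    by have := (M1 k, M1 l, ep m); case=> [[]]; nra.
  have p0 := lt_le_trans d0 de.
  have := bound m s _ p0; rewrite monomial2 // [b m s k 0 * _]mulrC.
  move=> /le_trans; apply.
  by rewrite lef_pV2 ?posrE.
have neq0 m s k : b m s k 0 != 0 by exact: inveig_neq0 (rb m s).
pose L s :=
  if occupied s then weight M (a s) * (monomial (a s) S * monomial (a s) T) else 0.
have Lcvg s :
    (fun m => w m s * (monomial (b m s) S * monomial (b m s) T)) @ \oo --> L s.
  rewrite /L; case: ifPn => hs.
    have [ra sa] := occupiedP s hs.
    have ba k : (fun m => b m s k 0) @ \oo --> a s k 0.
      by apply: cvg_inveig M0 ep e0 _ ra _ k => // m; exact: orthant_mul_gt0 sa _.
    apply: cvgM; last by apply: cvgM; exact: cvg_monomial.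
    by apply: cvg_weight => // k; exact: inveig_neq0 ra.
  (* The limit is [0] for an orthant without inverse eigenvector; the mixed
     moment is dominated by the two pure ones. *)
  have w0 : (fun m => w m s) @ \oo --> (0 : R).
    apply: (@empty_orthant_weight_cvg0 R n M s e (fun m => b m s) _
      (fun k => (M k k)^-1)) => //.
    by move=> x rx sx; move: hs; rewrite (occupied_inveig s x).
  have sq (U : {set 'I_n}) : (#|U| <= 1)%N ->
      (fun m => w m s * monomial (b m s) U ^+ 2) @ \oo --> (0 : R).
    case/card_le1P => [->|[l ->]].
      by under eq_fun do rewrite monomial0 expr1n mulr1.
    under eq_fun do rewrite monomial1.
    apply: (@escaping_moment_cvg0 R n M e (fun m => b m s) (fun m => w m s)
      (fun k => (M k k * M l l - M k l ^+ 2)^-1)) => // m k kl.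
    exact: bound2.
  apply/cvgr0Pnorm_le => d d0.
  have : (fun m => w m s * monomial (b m s) S ^+ 2 +
                   w m s * monomial (b m s) T ^+ 2) @ \oo --> (0 + 0 : R).
    by apply: cvgD; exact: sq.
  rewrite addr0 => /cvgr0Pnorm_le/(_ _ d0); apply: filterS => m.
  rewrite /= => /(le_trans (ler_norm _)); apply: le_trans.
  rewrite -mulrDr normrM gtr0_norm // ler_wpM2l ?(ltW (wp _ _)) // normrM.
  move: (monomial _ S) (monomial _ T) => x y.
  rewrite -(real_normK (num_real x)) -(real_normK (num_real y)).
  by have := sqr_ge0 (`|x| - `|y|); have := (normr_ge0 x, normr_ge0 y); case; nra.
rewrite big_mkcond /=.
have lhs : (fun m => principal_minor (M + (e m)%:M) T *
    \sum_s w m s * (monomial (b m s) S * monomial (b m s) T)) @ \oo -->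
    principal_minor M T * \sum_s L s.
  apply: cvgM; first exact: cvg_principal_minor.
  by apply: cvg_big => //; exact: add_continuous.
have E : (fun m => principal_minor (M + (e m)%:M) T *
    \sum_s w m s * (monomial (b m s) S * monomial (b m s) T)) =
    cst ((S == T)%:R : R).
  by apply/funext => m; case: (bP m).
by move: lhs; rewrite E => /cvg_lim <- //; rewrite lim_cst.
Qed.

(** * Finite sums and finite mixtures of Dirac measures *)

Lemma fsbig_image_fin {V : Type} {idx : V} (op : Monoid.com_law idx)
    {I : finType} {J : choiceType} (P : pred I) (h : I -> J) (F : J -> V) :
  {in P &, injective h} ->
  \big[op/idx]_(j \in h @` [set i | P i]) F j = \big[op/idx]_(i | P i) F (h i).
Proof.
move=> h_inj; rewrite fsbig_image; last first.
  by move=> i j /set_mem Pi /set_mem Pj; exact: h_inj.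
rewrite -[RHS]big_filter [RHS]fsbig_seq ?filter_uniq ?index_enum_uniq //.
apply: eq_fsbigl; apply/seteqP; split=> i /=.
  by rewrite mem_filter mem_index_enum andbT.
by rewrite mem_filter => /andP[].
Qed.

(** The measure is built by adding the atoms one at a time; normalizing by its
    total mass, which is [1], yields the probability structure without changing
    its values. *)
Lemma finite_mixture {d : measure_display} {T : measurableType d} {R : realType}
    {I : finType} (w : I -> R) (x : I -> T) :
  (forall i, 0 <= w i) -> \sum_i w i = 1 ->
  exists mu : probability T R,
    (forall A, mu A = \sum_i ((w i)%:E * \d_(x i) A))%E /\
    forall f : T -> R, measurable_fun [set: T] f ->
      (\int[mu]_t (f t)%:E = (\sum_i w i * f (x i))%:E)%E.
Proof.
move=> w0 w1.
have [mu [muE mu_int]] : exists mu : {measure set T -> \bar R},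
    (forall A, mu A = \sum_(i <- enum I) ((w i)%:E * \d_(x i) A))%E /\
    forall f : T -> \bar R, measurable_fun [set: T] f -> (forall t, 0 <= f t)%E ->
      (\int[mu]_t f t = \sum_(i <- enum I) (w i)%:E * f (x i))%E.
  elim: (enum I) => [|i s [mu [muE mu_int]]].
    exists mzero; split=> [A|f mf f0]; first by rewrite big_nil.
    by rewrite big_nil integral_measure_zero.
  exists (measure_add (mscale (NngNum (w0 i)) \d_(x i)) mu).
  split=> [A|f mf f0]; first by rewrite big_cons -muE; exact: measure_addE.
  rewrite ge0_integral_measure_add // mu_int // big_cons; congr (_ + _)%E.
  by rewrite ge0_integral_mscale // integral_dirac // diracT mul1e.
have muT : mu [set: T] = 1%E.
  rewrite muE big_enum /= -w1 -sumEFin; apply: eq_bigr => i _.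
  by rewrite diracT mule1.
(* Normalizing needs a fallback probability, here a Dirac measure; an index for
   it exists because the weights have sum [1]. *)
have [i0 _] : exists i : I, true.
  apply: contrapT => noI; have := oner_neq0 R; rewrite -w1 big1 ?eqxx // => i _.
  by exfalso; apply: noI; exists i.
pose P : probability T R := mnormalize mu \d_(x i0).
have PE A : P A = mu A.
  by rewrite /P /= /mnormalize muT /= onee_eq0 /= invr1 mule1.
exists P; split=> [A|f mf]; first by rewrite PE muE big_enum.
have mF : measurable_fun [set: T] (EFin \o f) by exact/measurable_EFinP.
have -> : (\int[P]_t (f t)%:E = \int[mu]_t (EFin \o f) t)%E.
  by apply: eq_measure_integral => A _ _; exact: PE.
rewrite integralE (mu_int _ (measurable_funepos mF)) //.
rewrite (mu_int _ (measurable_funeneg mF)) //.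
rewrite !big_enum /=.
rewrite funerpos funerneg /=.
under eq_bigr do rewrite -EFinM.
under [X in (_ - X)%E]eq_bigr do rewrite -EFinM.
rewrite !sumEFin -EFinB -sumrB; congr EFin; apply: eq_bigr => i _.
rewrite -mulrBr; congr (_ * _).
exact: (congr1 (fun g => g (x i)) (funrposBneg f)).
Qed.

Lemma measurable_continuousRn {R : realType} {n} (f : 'cV[R]_n -> R) :
  continuous f -> measurable_fun [set: borelRn R n] (f : borelRn R n -> R).
Proof.
move=> /continuousP cf; apply: (measurability _ (RGenOpens.measurableE R)).
move=> _ [_ [a [b ->] <-]]; rewrite setTI; apply: sub_sigma_algebra.
exact/cf/interval_open.
Qed.

(** * Inverse eigenvectors of Gram matrices *)

Lemma inverse_eigenvectors_complex {R : realType} {n} (M : 'M[R]_n)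
    (a : 'cV[R]_n) :
  inverse_eigenvectors M (complex_mx a) <-> inverse_eigenvector M a.
Proof.
rewrite /inverse_eigenvectors /inverse_eigenvector /= /complex_mx.
split=> H k; have := H k; rewrite -map_mxM !mxE -rmorphM /=.
  by move=> /(congr1 (@complex.Re R)).
by move=> ->.
Qed.

Lemma weight_complex {R : realType} {n} (M : 'M[R]_n) (a : 'cV[R]_n) :
  weight (complex_mx M) (complex_mx a) = real_complex R (weight M a).
Proof.
rewrite /weight /complex_mx rmorphM rmorph1 fmorphV -det_map_mx; congr (_ / \det _).
by rewrite map_mxD map_mx1 !map_mxM !map_diag_mx map_trmx.
Qed.

(** A second index [l] is what makes the diagonal positive: if [M k k = 0], then
    no [M k l] satisfies the strict inequality. *)
Lemma gram_bounds {R : realType} {n} (M : 'M[R]_n) : (2 <= n)%N ->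
  psd M ->
  (forall k l : 'I_n, k != l -> `|M k l| < Num.sqrt (M k k * M l l)) ->
  (forall k, 0 < M k k) /\ (forall k l, k != l -> M k l ^+ 2 < M k k * M l l).
Proof.
move=> n2 M0 ltM.
have M2 k l : k != l -> M k l ^+ 2 < M k k * M l l.
  move=> /ltM; case: (ltrP 0 (M k k * M l l)) => [p0 lt|p0].
    rewrite -(real_normK (num_real (M k l))) -[ltRHS]sqr_sqrtr ?(ltW p0) //.
    by rewrite ltrXn2r ?nnegrE ?sqrtr_ge0.
  by rewrite ler0_sqrtr // ltNge normr_ge0.
split=> // k.
have [l kl] : exists l, k != l.
  case: n n2 k {M M0 ltM M2} => [|[|n]] // _ k.
  have [->|k0] := eqVneq k ord0; last by exists ord0.
  by exists ord_max; rewrite -val_eqE.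
have Mk : 0 <= M k k.
  have := M0 (delta_mx k 0); rewrite /qform -colE (bigD1 k) //= big1 => [|i ik].
    by rewrite addr0 !mxE !eqxx mul1r.
  by rewrite !mxE (negPf ik) mul0r.
rewrite lt_neqAle Mk andbT eq_sym; apply/negP => /eqP Mk0.
by have := M2 k l kl; rewrite Mk0 mul0r ltNge sqr_ge0.
Qed.

Theorem theorem3 (R : realType) (n : nat) (M : 'M[R]_n)
    (n_ge2 : (2 <= n)%N)
    (gramM : real_gram M)
    (ltM : forall k l : 'I_n, k != l -> `|M k l| < Num.sqrt (M k k * M l l)) :
  let I := inverse_eigenvectors M in
  let c := weight (complex_mx M) in
  [/\ finite_set I,
      I `<=` range (@complex_mx R n 1),
      (forall a, I a -> 0 < c a),
      \sum_(a \in I) c a = 1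
    & \sum_(a \in I) c a *: (a *m a^T) = complex_mx (invmx (diag_part M))]
  /\
  exists P : probability (borelRn R n) R,
    [/\ (P : set (borelRn R n) -> \bar R) = inverse_eigenvector_measure M,
        centered P
      & has_second_moment P (invmx (diag_part M))].
Proof.
move=> I c.
have [symM M0'] := gramM.
have M0 : psd M by move=> x; rewrite -qformE.
have [M1 M2] := gram_bounds M n_ge2 M0 ltM.
pose occupied (s : {set 'I_n}) :=
  `[< exists a : 'cV[R]_n, inverse_eigenvector M a /\ in_orthant s a >].
have /boolp.choice[r occupiedP] (s : {set 'I_n}) :
    exists a : 'cV[R]_n, occupied s -> inverse_eigenvector M a /\ in_orthant s a.
  case: (boolP (occupied s)) => [/asboolP[a aP]|_]; first by exists a.
  by exists 0.
have occupied_inveig s x : inverse_eigenvector M x -> in_orthant s x -> occupied s.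
  by move=> rx sx; apply/asboolP; exists x.
have mom := low_moments M occupied r symM M0 M1 M2 occupiedP occupied_inveig.
have r_inj : {in occupied &, injective r}.
  move=> s t /occupiedP[_ ss] /occupiedP[_ tt] e; apply: orthant_inj ss _.
  by rewrite e; exact: tt.
have realE : real_inverse_eigenvectors M = r @` [set s | occupied s].
  apply/seteqP; split=> x /=.
    move=> /inverse_eigenvectors_complex rx.
    have x0 k : x k 0 != 0 by exact: inveig_neq0 rx.
    have sx := in_neg_coords x x0.
    have es := occupied_inveig _ _ rx sx; exists (neg_coords x) => //.
    have [ra sa] := occupiedP _ es.
    by apply: inveig_unique M0 ra rx _ => k; exact: orthant_mul_gt0 sa sx k.
  by move=> [s /occupiedP[ra _] <-]; exact/inverse_eigenvectors_complex.
have IE : I = @complex_mx R n 1 @` (r @` [set s | occupied s]).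
  rewrite -realE; apply/seteqP; split=> x /=; last by move=> [y Iy <-].
  move=> Ix; have xE := complex_inveig_real M x M0 Ix.
  exists (\col_k complex.Re (x k 0)); last by rewrite /complex_mx -xE.
  by rewrite /real_inverse_eigenvectors /= /complex_mx -xE.
have {}IE : I = (fun s => complex_mx (r s)) @` [set s | occupied s].
  rewrite IE; apply/seteqP; split=> x /=.
    by move=> [_ [s es <-] <-]; exists s.
  by move=> [s es <-]; exists (r s) => //; exists s.
have h_inj : {in occupied &, injective (fun s => complex_mx (r s))}.
  move=> s t es et /(map_mx_inj (f := real_complex R)) e; exact: r_inj.
have cp s : occupied s -> 0 < weight M (r s).
  move=> /occupiedP[/inveig_neq0 r0 _].
  by rewrite weight_bezoutian // ?invr_gt0 ?bezoutian_gt0 // => k.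
have set01 (k : 'I_n) : (finset.set0 == [set k]%SET) = false.
  by apply/eqP => /setP/(_ k); rewrite !inE eqxx.
have mom0 : \sum_(s | occupied s) weight M (r s) = 1.
  have := mom finset.set0 finset.set0; rewrite !cards0 eqxx principal_minor0 mul1r.
  move=> /(_ isT isT) E; rewrite -[RHS]E.
  by apply: eq_bigr => s _; rewrite monomial0 !mulr1.
have mom1 i : \sum_(s | occupied s) weight M (r s) * r s i 0 = 0.
  have := mom [set i]%SET finset.set0.
  rewrite cards1 cards0 eq_sym set01 principal_minor0 mul1r.
  move=> /(_ isT isT) E; rewrite -[RHS]E.
  by apply: eq_bigr => s _; rewrite monomial0 monomial1 mulr1.
have mom2 i j : \sum_(s | occupied s) weight M (r s) * (r s i 0 * r s j 0) =
    invmx (diag_part M) i j.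
  have -> : invmx (diag_part M) = diag_mx (\row_k (M k k)^-1).
    have DD : diag_mx (\row_k (M k k)^-1) *m diag_part M = 1%:M.
      rewrite mulmx_diag -diag_const_mx; congr diag_mx; apply/rowP => k.
      by rewrite !mxE mulVf // gt_eqF.
    by rewrite -[RHS]mulmx1 -(mulmxV (mulmx1_unit DD).2) mulmxA DD mul1mx.
  have := mom [set i]%SET [set j]%SET.
  rewrite !cards1 principal_minor1 => /(_ isT isT).
  under eq_bigr do rewrite !monomial1.
  rewrite (inj_eq set1_inj) => E; rewrite !mxE.
  apply: (mulfI (lt0r_neq0 (M1 j))); rewrite E mulrnAr.
  have [->|_] := eqVneq i j; last by rewrite mulr0n.
  by rewrite mulr1n mulfV // gt_eqF.
split.
  split.
  - by rewrite IE; apply: finite_image; exact: finite_finset.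
  - by rewrite IE => x [s _ <-]; exists (r s).
  - move=> a; rewrite IE => -[s es <-].
    by rewrite /c weight_complex ltcR cp.
  - rewrite IE fsbig_image_fin //= /c.
    by under eq_bigr do rewrite weight_complex; rewrite -rmorph_sum mom0.
  - rewrite IE fsbig_image_fin //= /c; apply/matrixP => i j.
    rewrite summxE mxE -mom2 rmorph_sum; apply: eq_bigr => s _.
    by rewrite weight_complex !mxE big_ord1 !mxE !rmorphM.
(* In an empty orthant [r] takes an arbitrary value, so the weight there has to
   be [0]. *)
pose w s := if occupied s then weight M (r s) else 0.
have w0 s : 0 <= w s by rewrite /w; case: ifP => // /cp/ltW.
have w1 : \sum_s w s = 1 by rewrite -big_mkcond.
have [P [PE Pint]] := finite_mixture w (fun s => r s : borelRn R n) w0 w1.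
have PintE f : continuous f ->
    (\int[P]_x (f x)%:E = (\sum_(s | occupied s) weight M (r s) * f (r s))%:E)%E.
  move=> cf; rewrite Pint; last exact: measurable_continuousRn.
  rewrite [in RHS]big_mkcond; congr EFin; apply: eq_bigr => s _.
  by rewrite /w; case: ifP => _; rewrite ?mul0r.
exists P; split.
- apply/funext => A; rewrite PE /inverse_eigenvector_measure realE.
  rewrite fsbig_image_fin //.
  rewrite [in RHS]big_mkcond; apply: eq_bigr => s _.
  by rewrite /w; case: ifP => _; rewrite ?mul0e.
- by move=> i; rewrite PintE ?mom1 //; exact: coord_continuous.
- move=> i j; rewrite (PintE (fun x => x i 0 * x j 0)) ?mom2 // => x.
  by apply: continuousM; exact: coord_continuous.
Qed.
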